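(* Let $G$ and $G^*$ be graphs on the vertex set $V=\{v_1,\dots,v_n\}$ with adjacency matrices $A$ and $A^*$, and let $S,S^*\subseteq V$ be non-empty. Let $W=W^S_G$ and $W^*=W^{S^*}_{G^*}$, with restrictions $A_W$ and $A^*_{W^*}$. Then the following are equivalent: (i) $W=W^*$; (ii) $G$ and $G^*$ have the same main eigenvalues and main eigenvectors for $S$ and $S^*$ respectively (i.e. the sets of main eigenvalues coincide and for each common main eigenvalue $\mu$ the main eigenvectors for $\mu$ coincide); (iii) $S=S^*$ and $A_W=A^*_{W^*}$. In particular, if $W$ and $W^*$ are the standard walk matrices of $G$ and $G^*$ (i.e. $S=S^*=V$), then $W=W^*$ if and only if $A_W=A^*_{W^*}$.
   Context: Graphs are finite, simple, undirected. For a graph with adjacency matrix $A$ on $V=\{v_1,\dots,v_n\}$ and non-empty $S\subseteq V$ with characteristic vector ${\rm e}\in\{0,1\}^n$: $W_{[i,j]}=[A^i{\rm e},\dots,A^j{\rm e}]$, and the walk matrix is $W=W^S=W_{[0,n-1]}$; the standard walk matrix is the case $S=V$. With $r={\rm rank}(W)$, the $W$-restriction of $A$ is $A_W=W_{[1,r]}\,(W_{[0,r-1]}^{\tt T}W_{[0,r-1]})^{-1}\,W_{[0,r-1]}^{\tt T}$ (the first $r$ columns of $W$ are linearly independent). Since $A$ is real symmetric, ${\rm e}={\rm e}_1+\dots+{\rm e}_r$ uniquely with nonzero eigenvectors ${\rm e}_k$ of $A$ for pairwise distinct eigenvalues $\mu_k$; these are the main eigenvectors and main eigenvalues for $S$.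 *)

(* Defs.v *)
From HB Require Import structures.
From mathcomp Require Import all_boot all_order all_algebra.
Set Implicit Arguments.
Unset Strict Implicit.
Unset Printing Implicit Defensive.
Import Order.TTheory GRing.Theory Num.Theory.
Local Open Scope ring_scope.

Record sgraph (n : nat) := SGraph {
  adj : rel 'I_n;
  adj_sym : symmetric adj;
  adj_irr : irreflexive adj }.

Definition adj_mx (R : rcfType) (n : nat) (G : sgraph n) : 'M[R]_n :=
  \matrix_(i, j) (adj G i j)%:R.

Definition char_vec (R : rcfType) (n : nat) (S : {set 'I_n}) : 'cV[R]_n :=
  \col_i (i \in S)%:R.

(* [A^i e, ..., A^(i+m-1) e], where e is the characteristic vector of S.  It is
   indexed by its first exponent i and its number of columns m, so that
   W_[i,j] = [A^i e, ..., A^j e] is walk_cols A S i (j - i + 1). *)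
Definition walk_cols (R : rcfType) (n : nat) (A : 'M[R]_n) (S : {set 'I_n})
    (i m : nat) : 'M[R]_(n, m) :=
  \matrix_(p < n, q < m) (A ^+ (i + q) *m char_vec R S) p 0.

Definition walk_mx (R : rcfType) (n : nat) (A : 'M[R]_n) (S : {set 'I_n}) :
    'M[R]_n :=
  walk_cols A S 0 n.

(* The inverse is a genuine one: the first r columns of the walk matrix are
   linearly independent, so their Gram matrix is invertible. *)
Definition walk_restriction (R : rcfType) (n : nat) (A : 'M[R]_n)
    (S : {set 'I_n}) : 'M[R]_n :=
  let r := \rank (walk_mx A S) in
  let W0 := walk_cols A S 0 r in
  let W1 := walk_cols A S 1 r in
  W1 *m invmx (W0^T *m W0) *m W0^T.

(* s lists the pairs (mu_k, e_k) of a decomposition e = e_1 + ... + e_r into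
   nonzero eigenvectors of A for pairwise distinct eigenvalues.  When A is
   symmetric such a list exists and is unique up to order. *)
Definition main_decomposition (R : rcfType) (n : nat) (A : 'M[R]_n)
    (S : {set 'I_n}) (s : seq (R * 'cV[R]_n)) : Prop :=
  [/\ uniq [seq p.1 | p <- s],
      forall p, p \in s -> p.2 != 0 /\ A *m p.2 = p.1 *: p.2
    & char_vec R S = \sum_(p <- s) p.2].

Definition main_eigenvector (R : rcfType) (n : nat) (A : 'M[R]_n)
    (S : {set 'I_n}) (mu : R) (v : 'cV[R]_n) : Prop :=
  exists2 s, main_decomposition A S s & (mu, v) \in s.

Definition main_eigenvalue (R : rcfType) (n : nat) (A : 'M[R]_n)
    (S : {set 'I_n}) (mu : R) : Prop :=
  exists v, main_eigenvector A S mu v.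

Definition same_main_eigenpairs (R : rcfType) (n : nat) (A A' : 'M[R]_n)
    (S S' : {set 'I_n}) : Prop :=
  (forall mu, main_eigenvalue A S mu <-> main_eigenvalue A' S' mu) /\
  (forall mu v v', main_eigenvector A S mu v -> main_eigenvector A' S' mu v' ->
     v = v').

(* Main.v *)
Require Import Defs.
From mathcomp Require Import all_boot all_order all_algebra.
From mathcomp Require Import complex.
Set Implicit Arguments.
Unset Strict Implicit.
Unset Printing Implicit Defensive.
Import GRing.Theory Num.Theory.
Local Open Scope ring_scope.

(* The three conditions each say that A^k e = A*^k e* for every k.
   A W-restriction is A composed with the orthogonal projection onto the span of
   the A^k e, so it sends A^k e to A^(k+1) e.  The main pairs determine A^k e as
   the sum of the mu^k e_mu; conversely, evaluating at A a polynomial that is 1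
   at mu and 0 at the other main eigenvalues extracts e_mu from the A^k e.
   Finally, W only records k < n: if rank W < n, A and A* agree on the
   span of the A^k e, and if W is invertible, A - A* is a symmetric matrix
   with zero diagonal vanishing on all columns of W but the last, hence is 0. *)

(** * Gram matrices and cyclic subspaces *)

(** If [u K K^T = 0], then [u K] has squared norm 0, and in an ordered field a vanishing sum of
    squares has only vanishing terms. *)
Lemma row_free_gram (R : realFieldType) (m n : nat) (K : 'M[R]_(m, n)) :
  row_free K -> K *m K^T \in unitmx.
Proof.
move=> freeK; rewrite -row_free_unit; apply: inj_row_free => u uKK0.
apply: (row_free_inj freeK); rewrite mul0mx.
have : (u *m K) *m (u *m K)^T = 0 by rewrite trmx_mul !mulmxA -(mulmxA u) uKK0 mul0mx.
move/matrixP/(_ 0 0); rewrite !mxE => /eqP.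
rewrite psumr_eq0 => [/allP sq0|j _]; last by rewrite [_^T _ _]mxE -expr2 sqr_ge0.
apply/rowP => j; have /sq0 := mem_index_enum j.
by rewrite [_^T _ _]mxE -expr2 sqrf_eq0 [RHS]mxE => /eqP.
Qed.

(** Vectors are stored as rows so that their span is a row space; walk vectors enter transposed. *)
Definition first_rows (F : fieldType) (n : nat) (u : nat -> 'rV[F]_n) (m : nat) :
    'M[F]_(m, n) :=
  \matrix_(q < m) u q.

Lemma row_first_rows (F : fieldType) (n : nat) (u : nat -> 'rV[F]_n) (m k : nat) :
  (k < m)%N -> (u k <= first_rows u m)%MS.
Proof.
move=> lt_km; rewrite -[u k](rowK (fun q : 'I_m => u q) (Ordinal lt_km)).
exact: row_sub.
Qed.

Lemma first_rows_free_recr (F : fieldType) (n : nat) (u : nat -> 'rV[F]_n) (m : nat) :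
  row_free (first_rows u m) -> ~~ (u m <= first_rows u m)%MS ->
  row_free (first_rows u m.+1).
Proof.
move=> freeK notin; apply: inj_row_free => v.
have -> : v *m first_rows u m.+1 =
    (\row_(q < m) v 0 (widen_ord (leqnSn m) q)) *m first_rows u m +
    v 0 ord_max *: u m.
  rewrite !mulmx_sum_row big_ord_recr /= !rowK /=; congr (_ + _).
  by apply: eq_bigr => q _; rewrite !rowK mxE.
move=> v0; have vm0 : v 0 ord_max = 0.
  apply: contraNeq notin => nz; apply/submxP.
  (* Dividing the relation by a nonzero last coefficient would put [u m] in the span of its
     predecessors. *)
  exists (- (v 0 ord_max)^-1 *: \row_(q < m) v 0 (widen_ord (leqnSn m) q)).
  move/eqP: v0; rewrite addr_eq0 -scalemxAl => /eqP ->.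
  by rewrite scalerN scaleNr opprK scalerA mulVf // scale1r.
move: v0; rewrite vm0 scale0r addr0 -[X in _ = X](mul0mx _ (first_rows u m)).
move/(row_free_inj freeK)/rowP=> v0.
apply/rowP => q; rewrite [RHS]mxE.
case: (ltnP q m) => [lt_qm | le_mq].
  have := v0 (Ordinal lt_qm); rewrite !mxE => <-.
  by congr (v _ _); apply: val_inj.
rewrite -vm0; congr (v _ _); apply: val_inj => /=.
by apply/eqP; rewrite eqn_leq le_mq -ltnS ltn_ord.
Qed.

(** Take the first [m] at which [u m] depends on its predecessors; it exists because [n + 1] vectors
    of length [n] are dependent. *)
Lemma first_rows_free_dependent (F : fieldType) (n : nat) (u : nat -> 'rV[F]_n) :
  exists m, [/\ (m <= n)%N, row_free (first_rows u m) &
                (u m <= first_rows u m)%MS].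
Proof.
have [freeK|[j lt_jn hj]] : row_free (first_rows u n.+1) \/
    exists2 j, (j < n.+1)%N &
      row_free (first_rows u j) /\ (u j <= first_rows u j)%MS.
- elim: n.+1 => [|m [freeK|[j lt_jm hj]]].
  + by left; rewrite -row_leq_rank.
  + have [um|um] := boolP (u m <= first_rows u m)%MS; first by right; exists m.
    by left; apply: first_rows_free_recr.
  + by right; exists j => //; apply: ltnW.
- by have := rank_leq_col (first_rows u n.+1); rewrite (eqP freeK) ltnn.
- by case: hj; exists j.
Qed.

(** [B] shifts the sequence, so the span is [B]-invariant: only the last row has an image outside
    the list, and that image is [u m]. *)
Lemma first_rows_stable (F : fieldType) (n : nat) (B : 'M[F]_n)
    (u : nat -> 'rV[F]_n) (m : nat) :
  (forall k, u k.+1 = u k *m B) -> (u m <= first_rows u m)%MS ->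
  forall k, (u k <= first_rows u m)%MS.
Proof.
move=> uS um; have stable : (first_rows u m *m B <= first_rows u m)%MS.
  apply/row_subP => q; rewrite row_mul rowK -uS.
  by case: (ltngtP q.+1 m) (ltn_ord q) => // [/row_first_rows // | ->].
elim=> [|k IHk]; last by rewrite uS (submx_trans _ stable) // submxMr.
(* For [m = 0] the base case is the assumption on [u m] itself. *)
by case: m um {stable} => // m _; apply: row_first_rows.
Qed.

(** * Walk vectors and the restriction *)

Lemma walk_vecS (R : rcfType) (n : nat) (A : 'M[R]_n) (v : 'cV[R]_n) (k : nat) :
  A ^+ k.+1 *m v = A *m (A ^+ k *m v).
Proof. by rewrite exprS; apply: esym (mulmxA _ _ _). Qed.

Lemma tr_walk_cols0 (R : rcfType) (n : nat) (A : 'M[R]_n) (S : {set 'I_n}) (m : nat) :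
  (walk_cols A S 0 m)^T =
  first_rows (fun k => (A ^+ k *m char_vec R S)^T) m.
Proof. by apply/matrixP => q p; rewrite !mxE. Qed.

(** If [m] is the first index of dependence, the first [m] walk vectors span the same space as all
    [n] columns of the walk matrix, so [m] is its rank. *)
Lemma walk_rank_span (R : rcfType) (n : nat) (A : 'M[R]_n) (S : {set 'I_n})
    (r := \rank (walk_mx A S)) :
  row_free (walk_cols A S 0 r)^T /\
  forall k, exists a, A ^+ k *m char_vec R S = walk_cols A S 0 r *m a.
Proof.
pose u k := (A ^+ k *m char_vec R S)^T.
have uS k : u k.+1 = u k *m A^T by rewrite /u walk_vecS trmx_mul.
have [m [le_mn freeK um]] := first_rows_free_dependent u.
have span := first_rows_stable uS um.
have rm : r = m.
  rewrite /r -mxrank_tr tr_walk_cols0 -/u -(eqP freeK); apply/eqmx_rank/andP.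
  split; apply/row_subP => q; rewrite rowK // row_first_rows //.
  exact: leq_trans (ltn_ord q) le_mn.
rewrite rm tr_walk_cols0; split => // k.
have /submxP[a /(congr1 trmx)] := span k.
rewrite /u trmxK trmx_mul => ->; exists a^T.
by rewrite -tr_walk_cols0 trmxK.
Qed.

Lemma walk_cols1E (R : rcfType) (n : nat) (A : 'M[R]_n) (S : {set 'I_n}) (m : nat) :
  walk_cols A S 1 m = A *m walk_cols A S 0 m.
Proof.
apply/matrixP => p q; rewrite mxE walk_vecS !mxE.
by apply: eq_bigr => j _; rewrite [walk_cols _ _ _ _ _ _]mxE.
Qed.

Lemma walk_restriction_walk (R : rcfType) (n : nat) (A : 'M[R]_n)
    (S : {set 'I_n}) (k : nat) :
  walk_restriction A S *m (A ^+ k *m char_vec R S) = A ^+ k.+1 *m char_vec R S.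
Proof.
have [freeK span] := walk_rank_span A S; have [a Ek] := span k.
rewrite walk_vecS Ek /walk_restriction walk_cols1E !mulmxA.
(* The Gram matrix of the first [r] columns meets its inverse: the projection fixes their span. *)
rewrite -(mulmxA _ _^T) mulmxKV //.
by have := row_free_gram freeK; rewrite trmxK.
Qed.

(** * From the walk matrix to all walk vectors *)

Definition same_walks (R : rcfType) (n : nat) (A A' : 'M[R]_n) (S S' : {set 'I_n}) :=
  forall k, A ^+ k *m char_vec R S = A' ^+ k *m char_vec R S'.

Lemma walk_mxP (R : rcfType) (n : nat) (A A' : 'M[R]_n) (S S' : {set 'I_n}) :
  walk_mx A S = walk_mx A' S' <->
  forall k, (k < n)%N -> A ^+ k *m char_vec R S = A' ^+ k *m char_vec R S'.
Proof.
split=> [eqW k lt_kn | eqW].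
  by apply/colP => p; have /matrixP/(_ p (Ordinal lt_kn)) := eqW; rewrite !mxE.
apply/matrixP => p q; have /colP/(_ p) := eqW q (ltn_ord q).
by rewrite !mxE.
Qed.

(* W^T D W is symmetric and only its last diagonal entry c can be nonzero, so
   D = c w^T w with w the last row of W^-1, and the diagonal of D is c w_i^2. *)
Lemma sym0diag_eq0 (R : realFieldType) (n : nat) (D W : 'M[R]_n.+1) :
  D^T = D -> (forall i, D i i = 0) -> W \in unitmx ->
  (forall j, j != ord_max -> D *m col j W = 0) -> D = 0.
Proof.
move=> symD diagD unitW DW0.
pose M := W^T *m D *m W; pose c := M ord_max ord_max.
have symM i j : M i j = M j i.
  suff /matrixP/(_ j i) : M^T = M by rewrite mxE.
  by rewrite /M !trmx_mul symD trmxK mulmxA.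
have M0 i j : j != ord_max -> M i j = 0.
  move=> neq_j; have -> : M i j = (W^T *m (D *m col j W)) i 0.
    by rewrite colE !mulmxA -colE [RHS]mxE.
  by rewrite DW0 // mulmx0 mxE.
have defM :
    M = c *: ((delta_mx ord_max 0 : 'cV_n.+1) *m (delta_mx 0 ord_max : 'rV_n.+1)).
  rewrite mul_delta_mx; apply/matrixP => i j; rewrite [RHS]mxE [delta_mx _ _ _ _]mxE.
  have [->|nj] := eqVneq j ord_max; last by rewrite andbF mulr0 M0.
  by have [->|ni] := eqVneq i ord_max; rewrite ?mulr1 // mulr0 symM M0.
have [w defD] : exists w : 'rV_n.+1, D = c *: (w^T *m w).
  exists (delta_mx 0 ord_max *m invmx W).
  transitivity ((invmx W)^T *m M *m invmx W).
    rewrite /M !mulmxA -trmx_mul mulmxV // trmx1 mul1mx.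
    by rewrite -mulmxA mulmxV // mulmx1.
  by rewrite defM -scalemxAr -scalemxAl trmx_mul trmx_delta !mulmxA.
have [c0|nz_c] := eqVneq c 0; first by rewrite defD c0 scale0r.
suff w0 : w = 0 by rewrite defD w0 mulmx0 scaler0.
apply/rowP => i; have := diagD i; rewrite defD !mxE big_ord1 [_^T _ _]mxE -expr2.
by move/eqP; rewrite mulf_eq0 (negPf nz_c) sqrf_eq0 => /eqP ->.
Qed.

Lemma walk_mx_walks (R : rcfType) (n : nat) (A A' : 'M[R]_n) (S S' : {set 'I_n}) :
  A^T = A -> A'^T = A' -> (forall i, A i i = A' i i) ->
  walk_mx A S = walk_mx A' S' -> same_walks A A' S S'.
Proof.
case: n => [|n] in A A' S S' *; first by move=> _ _ _ _ k; rewrite !flatmx0.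
move=> symA symA' eq_diag eqW; have eq_walk := (walk_mxP _ _ _ _).1 eqW.
have [_ span] := walk_rank_span A S; set r := \rank _ in span.
(* The dimension is now [n.+1]: the walk matrix records exponents up to [n], hence the image of
   every column except the last. *)
have agree j : (j < n)%N ->
    A *m (A ^+ j *m char_vec R S) = A' *m (A ^+ j *m char_vec R S).
  by move=> lt_jn; rewrite -walk_vecS eq_walk // walk_vecS eq_walk // ltnW.
have AW0 : A *m walk_cols A S 0 r = A' *m walk_cols A S 0 r.
  (* Below full rank, the first [r] columns avoid the last one, so [agree] covers them all. *)
  have [lt_rn|le_nr] := ltnP r n.+1.
    apply/matrixP => p q; have lt_qn : (q < n)%N by apply: (leq_trans (ltn_ord q)).
    have /colP/(_ p) := agree q lt_qn; rewrite !mxE => E.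
    under eq_bigr do rewrite [walk_cols _ _ _ _ _ _]mxE.
    by under [RHS]eq_bigr do rewrite [walk_cols _ _ _ _ _ _]mxE.
  suff /subr0_eq -> : A - A' = 0 by [].
  apply: (@sym0diag_eq0 _ _ _ (walk_mx A S)).
  - by rewrite linearB /= symA symA'.
  - by move=> i; rewrite !mxE eq_diag subrr.
  - by rewrite -row_full_unit -col_leq_rank.
  - move=> j neq_j; have lt_jn : (j < n)%N by rewrite ltn_neqAle neq_j -ltnS ltn_ord.
    have -> : col j (walk_mx A S) = A ^+ j *m char_vec R S.
      by apply/colP => p; rewrite !mxE.
    by rewrite mulmxBl agree // subrr.
elim=> [|k IHk]; first by rewrite eq_walk.
by have [a Ek] := span k; rewrite !walk_vecS -IHk Ek !mulmxA AW0.
Qed.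

Lemma char_vec_inj (R : rcfType) (n : nat) : injective (@char_vec R n).
Proof.
move=> S S' /colP eqS; apply/setP => i; have := eqS i; rewrite !mxE.
by case: (i \in S); case: (i \in S') => // /eqP; rewrite ?oner_eq0 // eq_sym oner_eq0.
Qed.

Lemma same_walks_restriction (R : rcfType) (n : nat) (A A' : 'M[R]_n)
    (S S' : {set 'I_n}) :
  same_walks A A' S S' <-> S = S' /\ walk_restriction A S = walk_restriction A' S'.
Proof.
split=> [eq_walk | [-> eqAW]]; last first.
  by elim=> [|k IHk] //; rewrite -!walk_restriction_walk IHk eqAW.
split; first by apply: (@char_vec_inj R); have := eq_walk 0%N; rewrite !mul1mx.
have eqW i m : walk_cols A S i m = walk_cols A' S' i m.
  by apply/matrixP => p q; rewrite [LHS]mxE [RHS]mxE eq_walk.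
by rewrite /walk_restriction /walk_mx !eqW.
Qed.

(** * Existence of main decompositions *)

(** The spectral theorem is applied to [A] as a Hermitian matrix over the complex extension of [R].
    The [d j] may repeat; [main_decomposition_exists] groups equal ones and drops zero sums. *)
Lemma symmetric_eigenvector_sum (R : rcfType) (n : nat) (A : 'M[R]_n) (v : 'cV[R]_n) :
  A^T = A ->
  exists (d : 'I_n -> R) (x : 'I_n -> 'cV[R]_n),
    (forall j, A *m x j = d j *: x j) /\ v = \sum_j x j.
Proof.
move=> symA; pose toC := real_complex R; pose AC := map_mx toC A.
have hermA : AC \is hermsymmx.
  apply: realsym_hermsym.
    by apply/is_hermitianmxP; rewrite expr0 scale1r map_mx_id // map_trmx symA.
  by apply/mxOverP => i j; rewrite mxE complex_real.
have /orthomx_spectralP := hermitian_normalmx hermA.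
have := hermitian_spectral_diag_real hermA; have := spectral_unit AC.
move: (spectralmx AC) (spectral_diag AC) => P d unitP /mxOverP realD defA.
(* The component of [v] along the [j]-th vector of the eigenbasis formed by the columns of
   [invmx P]. *)
pose y j := (P *m map_mx toC v) j 0 *: col j (invmx P).
have Ay j : AC *m y j = d 0 j *: y j.
  rewrite /y -scalemxAr scalerA mulrC -scalerA; congr (_ *: _).
  rewrite defA colE !mulmxA mulmxK // -mulmxA -[diag_mx d *m _]colE.
  rewrite scalemxAr; congr (_ *m _).
  apply/colP => i; rewrite !mxE eqxx andbT.
  by case: eqVneq => [->|_]; rewrite ?mulr1 ?mulr0.
(* A and the d_j are real, so real parts of the complex eigenvectors y_j are
   again eigenvectors, possibly zero. *)
exists (fun j => complex.Re (d 0 j)), (fun j => map_mx (@complex.Re R) (y j)).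
split=> [j|].
  apply/colP => i; have /colP/(_ i) := Ay j.
  rewrite [LHS]mxE [in X in _ = X -> _]mxE.
  move=> /(congr1 (@complex.Re R)); rewrite raddf_sum /= => E.
  rewrite [RHS]mxE [in RHS]mxE.
  transitivity (complex.Re (d 0 j * y j i 0)).
    rewrite -E [LHS]mxE; apply: eq_bigr => k _; rewrite mxE.
    rewrite [AC _ _]mxE; case: (y j k 0) => a b /=.
    by rewrite mul0r subr0.
  rewrite -{1}(RRe_real (realD 0 j)); case: (y j i 0) => a b /=.
  by rewrite mul0r subr0.
apply/colP => i.
have : map_mx toC v = \sum_j y j.
  rewrite -[LHS](mulKmx unitP); apply/colP=> k; rewrite mxE summxE.
  by apply: eq_bigr => j _; rewrite [RHS]mxE [col _ _ _ _]mxE mulrC.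
move/colP/(_ i)/(congr1 (@complex.Re R)); rewrite mxE /= => ->.
by rewrite !summxE raddf_sum; apply: eq_bigr => j _; rewrite [RHS]mxE.
Qed.

Lemma main_decomposition_exists (R : rcfType) (n : nat) (A : 'M[R]_n) (S : {set 'I_n}) :
  A^T = A -> exists s, main_decomposition A S s.
Proof.
move=> /(symmetric_eigenvector_sum (char_vec R S)) [d [x [Ax defe]]].
pose comp mu := \sum_(j | d j == mu) x j.
pose ds := undup (codom d).
exists [seq (mu, comp mu) | mu <- ds & comp mu != 0]; split.
- by rewrite -map_comp map_id filter_uniq // undup_uniq.
- move=> p /mapP[mu]; rewrite mem_filter => /andP[nz _] -> /=; split=> //.
  by rewrite mulmx_sumr scaler_sumr; apply: eq_bigr => j /eqP <-.
rewrite big_map big_filter /= big_mkcond /= defe.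
under [RHS]eq_bigr => mu _.
  have -> : (if comp mu != 0 then comp mu else 0) = comp mu by case: eqP.
  rewrite /comp big_mkcond /=.
  over.
rewrite exchange_big /=; apply: eq_bigr => j _.
rewrite (bigD1_seq (d j)) ?undup_uniq ?mem_undup ?codom_f //= eqxx.
by rewrite big1 ?addr0 // => mu; rewrite eq_sym => /negPf ->.
Qed.

(** * Recovering main pairs from walk vectors *)

(** A Lagrange interpolation polynomial, normalised at [mu]. *)
Lemma isolating_poly (F : fieldType) (l : seq F) (mu : F) :
  exists2 q : {poly F}, q.[mu] = 1 & forall x, x \in l -> x != mu -> q.[x] = 0.
Proof.
pose p := \prod_(x <- l | x != mu) ('X - x%:P).
have nz_p : p.[mu] != 0.
  rewrite horner_prod prodf_seq_neq0; apply/allP => x _; apply/implyP.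
  by rewrite !hornerE subr_eq0 eq_sym.
exists (p.[mu]^-1 *: p) => [|x x_l neq_x]; first by rewrite hornerZ mulVf.
suff px0 : p.[x] = 0 by rewrite hornerZ px0 mulr0.
by rewrite horner_prod (big_rem x) //= neq_x hornerXsubC subrr mul0r.
Qed.

Lemma main_decomposition_walk (R : rcfType) (n : nat) (A : 'M[R]_n)
    (S : {set 'I_n}) s (k : nat) :
  main_decomposition A S s ->
  A ^+ k *m char_vec R S = \sum_(p <- s) p.1 ^+ k *: p.2.
Proof.
move=> [_ eig ->]; elim: k => [|k IHk].
  by rewrite mul1mx; apply: eq_bigr => p _; rewrite expr0 scale1r.
rewrite walk_vecS IHk mulmx_sumr big_seq [RHS]big_seq.
apply: eq_bigr => p /eig[_ Ap]; rewrite -scalemxAr Ap scalerA.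
by rewrite exprSr.
Qed.

(** Both sides are [q(A) e]; the left one involves only walk vectors, so it transfers between
    matrices with the same walks. *)
Lemma main_decomposition_poly (R : rcfType) (n : nat) (A : 'M[R]_n)
    (S : {set 'I_n}) s (q : {poly R}) :
  main_decomposition A S s ->
  \sum_(k < size q) q`_k *: (A ^+ k *m char_vec R S) =
  \sum_(p <- s) q.[p.1] *: p.2.
Proof.
move=> dec; under eq_bigr do rewrite (main_decomposition_walk _ dec) scaler_sumr.
rewrite exchange_big /=; apply: eq_bigr => p _.
by rewrite horner_coef scaler_suml; apply: eq_bigr => k _; rewrite scalerA.
Qed.

Lemma uniq_map_inj (T1 T2 : eqType) (f : T1 -> T2) (s : seq T1) :
  uniq (map f s) -> {in s &, injective f}.
Proof.
elim: s => //= x s IHs /andP[fx_s /IHs inj_s] y z.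
rewrite !inE => /predU1P[->|sy] /predU1P[->|sz] // eqf.
- by rewrite eqf map_f in fx_s.
- by rewrite -eqf map_f in fx_s.
- exact: inj_s.
Qed.

Lemma main_decomposition_isolate (R : rcfType) (n : nat) (A : 'M[R]_n)
    (S : {set 'I_n}) s p (q : {poly R}) :
  main_decomposition A S s -> p \in s -> q.[p.1] = 1 ->
  (forall x, x \in [seq p.1 | p <- s] -> x != p.1 -> q.[x] = 0) ->
  \sum_(p <- s) q.[p.1] *: p.2 = p.2.
Proof.
move=> [uniq_s _ _] sp q1 q0.
rewrite (bigD1_seq p) ?(map_uniq uniq_s) //= q1 scale1r big_seq_cond.
rewrite big1 ?addr0 // => p' /andP[sp' neq_p].
rewrite q0 ?scale0r ?map_f //; apply: contra neq_p => /eqP eq_p1.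
by apply/eqP; apply: (uniq_map_inj uniq_s).
Qed.

Lemma main_decomposition_sub (R : rcfType) (n : nat) (A A' : 'M[R]_n)
    (S S' : {set 'I_n}) s s' :
  same_walks A A' S S' -> main_decomposition A S s ->
  main_decomposition A' S' s' -> {subset s <= s'}.
Proof.
move=> eq_walk dec dec' p sp; have [_ /(_ p sp)[nz_p _] _] := dec.
(* One [q] serves both decompositions, so it must vanish at the other eigenvalues of each. *)
have [q q1 q0] := isolating_poly ([seq p.1 | p <- s] ++ [seq p.1 | p <- s']) p.1.
have : \sum_(p <- s') q.[p.1] *: p.2 = p.2.
  rewrite -(main_decomposition_poly q dec'); under eq_bigr do rewrite -eq_walk.
  rewrite (main_decomposition_poly q dec).
  by apply: (main_decomposition_isolate dec) => // x s_x; apply: q0; rewrite mem_cat s_x.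
have q0' x : x \in [seq p.1 | p <- s'] -> x != p.1 -> q.[x] = 0.
  by move=> s_x; apply: q0; rewrite mem_cat s_x orbT.
have [/mapP[p' sp' eq1]|notin] := boolP (p.1 \in [seq p.1 | p <- s']).
  rewrite (main_decomposition_isolate dec' sp') -?eq1 // => eq2.
  by rewrite [p]surjective_pairing eq1 -eq2 -surjective_pairing.
(* If [p.1] were absent from [s'], every term would vanish, forcing the eigenvector [p.2] to be
   0. *)
rewrite big_seq big1 => [eq2 | p' sp']; first by rewrite -eq2 eqxx in nz_p.
rewrite q0' ?scale0r ?map_f //; apply: contraNneq notin => <-.
exact: map_f.
Qed.

Lemma same_walks_sym (R : rcfType) (n : nat) (A A' : 'M[R]_n) (S S' : {set 'I_n}) :
  same_walks A A' S S' -> same_walks A' A S' S.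
Proof. by move=> eq_walk k; rewrite eq_walk. Qed.

(** Uniqueness of the decomposition is [main_decomposition_sub] for one matrix compared with
    itself. *)
Lemma main_eigenvectorE (R : rcfType) (n : nat) (A : 'M[R]_n) (S : {set 'I_n}) s mu v :
  main_decomposition A S s -> main_eigenvector A S mu v <-> (mu, v) \in s.
Proof.
move=> dec; split=> [[s' dec' s'p]|sp]; last by exists s.
by apply: (main_decomposition_sub _ dec' dec).
Qed.

Lemma same_walks_main_eigenpairs (R : rcfType) (n : nat) (A A' : 'M[R]_n)
    (S S' : {set 'I_n}) :
  A^T = A -> A'^T = A' ->
  same_walks A A' S S' <-> same_main_eigenpairs A A' S S'.
Proof.
move=> /main_decomposition_exists-/(_ S)[s dec].
move=> /main_decomposition_exists-/(_ S')[s' dec'].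
have evec mu v := main_eigenvectorE mu v dec.
have evec' mu v := main_eigenvectorE mu v dec'.
split=> [eq_walk | [eq_val eq_vec]].
  have eq_s : s =i s'.
    move=> p; apply/idP/idP; first exact: (main_decomposition_sub eq_walk).
    exact: (main_decomposition_sub (same_walks_sym eq_walk)).
  split=> [mu|mu v v' /evec sv /evec' s'v].
    split=> -[v vP]; exists v; first by apply/evec'; rewrite -eq_s; apply/evec.
    by apply/evec; rewrite eq_s; apply/evec'.
  have [uniq_s _ _] := dec.
  have : (mu, v) = (mu, v') by apply: (uniq_map_inj uniq_s); rewrite // eq_s.
  by case.
have eq_s : s =i s'.
  move=> [mu v]; apply/idP/idP => [/evec vP|/evec' vP].
    (* A common eigenvalue only yields some [v'] on the other side; [eq_vec] identifies it with
       [v]. *)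
    have [v' v'P] := (eq_val mu).1 (ex_intro _ v vP).
    by apply/evec'; rewrite (eq_vec _ _ _ vP v'P).
  have [v' v'P] := (eq_val mu).2 (ex_intro _ v vP).
  by apply/evec; rewrite -(eq_vec _ _ _ v'P vP).
move=> k; rewrite (main_decomposition_walk k dec) (main_decomposition_walk k dec').
apply: perm_big; apply: uniq_perm => //.
- by case: dec => /map_uniq.
- by case: dec' => /map_uniq.
Qed.

Theorem theorem6p1 (R : rcfType) (n : nat) (G G' : sgraph n)
    (S S' : {set 'I_n}) (hS : S != set0) (hS' : S' != set0) :
  let A := adj_mx R G in
  let A' := adj_mx R G' in
  [/\ walk_mx A S = walk_mx A' S' <-> same_main_eigenpairs A A' S S',
      same_main_eigenpairs A A' S S' <->
        (S = S' /\ walk_restriction A S = walk_restriction A' S'),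
      walk_mx A S = walk_mx A' S' <->
        (S = S' /\ walk_restriction A S = walk_restriction A' S')
    & walk_mx A [set: 'I_n] = walk_mx A' [set: 'I_n] <->
        walk_restriction A [set: 'I_n] = walk_restriction A' [set: 'I_n]].
Proof.
move=> A A'; have symA (H : sgraph n) : (adj_mx R H)^T = adj_mx R H.
  by apply/matrixP => i j; rewrite !mxE (adj_sym H).
have walkP T T' : walk_mx A T = walk_mx A' T' <-> same_walks A A' T T'.
  split=> [|eq_walk]; last by apply/walk_mxP.
  apply: walk_mx_walks; [exact: symA | exact: symA | move=> i].
  (* Graphs have no loops, so both diagonals are zero. *)
  by rewrite !mxE !adj_irr.
have eigP := same_walks_main_eigenpairs S S' (symA G) (symA G').
have resP T T' := same_walks_restriction A A' T T'.
split.
- exact: iff_trans (walkP _ _) eigP.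
- exact: iff_trans (iff_sym eigP) (resP _ _).
- exact: iff_trans (walkP _ _) (resP _ _).
- apply: iff_trans (walkP _ _) (iff_trans (resP _ _) _).
  by split=> [[]|].
Qed.
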